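(* If $S$ is an $AG^{*}$ groupoid or an $AG^{**}$ groupoid, then $[S]$ is a laterally commutative semiheap.
   Context: A groupoid is a set with a binary operation, written as juxtaposition. A groupoid is right modular if $(xy)z=(zy)x$, weakly associative if $(xy)z=y(xz)$, and left lateral if $x(yz)=y(xz)$, for all $x,y,z$. An $AG^{*}$ groupoid is a right modular, weakly associative groupoid; an $AG^{**}$ groupoid is a right modular, left lateral groupoid. $[S]$ denotes the set $S$ with its natural ternary operation $[abc]=(ab)c$. A ternary operation $[\ ]$ is a semiheap if $[[xyz]uv]=[x[uzy]v]=[xy[zuv]]$ for all $x,y,z,u,v$, and is laterally commutative if $[xyz]=[zyx]$ for all $x,y,z$. *)

(* Defs.v *)
From mathcomp Require Import all_boot.

Set Implicit Arguments.
Unset Strict Implicit.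
Unset Printing Implicit Defensive.

(* A groupoid (magma) is an arbitrary type S with a binary operation mul;
   mul x y stands for the juxtaposition xy. MathComp's magmaType is avoided
   because it would also require a choiceType structure on S. *)
Section Groupoid.
Variables (S : Type) (mul : S -> S -> S).
Local Notation "x * y" := (mul x y).

Definition right_modular := forall x y z, (x * y) * z = (z * y) * x.

Definition weakly_associative := forall x y z, (x * y) * z = y * (x * z).

Definition left_lateral := left_commutative mul.

Definition AGstar := right_modular /\ weakly_associative.

Definition AGstarstar := right_modular /\ left_lateral.

Definition natural_ternary (a b c : S) : S := (a * b) * c.

End Groupoid.

Section Ternary.
Variables (S : Type) (t : S -> S -> S -> S).

Definition semiheap := forall x y z u v,
  t (t x y z) u v = t x (t u z y) v /\ t x (t u z y) v = t x y (t z u v).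

Definition laterally_commutative := forall x y z, t x y z = t z y x.

End Ternary.

(* Main.v *)
From mathcomp Require Import all_boot.
Require Import Defs.

(* Right modularity alone gives the medial law (ab)(cd) = (ac)(bd) and
   ((xy)z)u = (uz)(xy).  In an AG** groupoid the semiheap identities then follow
   by left laterality.  In an AG* groupoid weak associativity makes a product
   (ab)(cd) invariant under all permutations of its four factors, and
   ((uz)(xy))v = (xy)((zu)v) and (uz)(xy) = (yx)(uz) = x((uz)y) follow. *)

(** Three uses of right modularity: [(ab)(cd) = ((cd)b)a = ((bd)c)a = (ac)(bd)]. *)
Lemma right_modular_medial (S : Type) (mul : S -> S -> S) :
  right_modular mul -> interchange mul mul.
Proof. by move=> rm a b c d; rewrite (rm a) (rm c) (rm (mul b d)). Qed.

Lemma right_modular_laterally_commutative (S : Type) (mul : S -> S -> S) :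
  right_modular mul -> laterally_commutative (natural_ternary mul).
Proof. exact. Qed.

(** [a(bc) = (ba)c = (ca)b = a(cb)]. *)
Lemma AGstar_mulC_inner (S : Type) (mul : S -> S -> S) :
  AGstar mul -> forall a b c, mul a (mul b c) = mul a (mul c b).
Proof. by move=> [rm wa] a b c; rewrite -(wa b a c) (rm b) (wa c). Qed.

(** Weak associativity turns the sides into [b((ca)d)] and [b(d(ca))]. Swaps of factors 1 and 4, 2
    and 3, 3 and 4 generate all permutations. *)
Lemma AGstar_rotate (S : Type) (mul : S -> S -> S) : AGstar mul ->
  forall a b c d, mul (mul a b) (mul c d) = mul (mul d b) (mul c a).
Proof.
move=> AG a b c d; have [_ wa] := AG.
rewrite (wa a) (wa d) -(wa c a d).
exact: AGstar_mulC_inner AG _ _ _.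
Qed.

Lemma AGstar_mulC_left (S : Type) (mul : S -> S -> S) : AGstar mul ->
  forall a b c d, mul (mul a b) (mul c d) = mul (mul b a) (mul c d).
Proof.
move=> AG a b c d; have medial := right_modular_medial S mul (proj1 AG).
(* [(ab)(cd) = (db)(ac) = (da)(bc) = (ba)(cd)]. *)
rewrite (AGstar_rotate _ _ AG a) (AGstar_mulC_inner _ _ AG _ c a) (medial d).
by rewrite (AGstar_mulC_inner _ _ AG _ b c) (AGstar_rotate _ _ AG d).
Qed.

Lemma AGstar_mulC_outer (S : Type) (mul : S -> S -> S) : AGstar mul ->
  forall a b c d, mul (mul a b) (mul c d) = mul (mul c d) (mul a b).
Proof.
move=> AG a b c d; have medial := right_modular_medial S mul (proj1 AG).
rewrite (AGstar_rotate _ _ AG a) (medial d) (AGstar_mulC_left _ _ AG d).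
exact: AGstar_mulC_inner AG _ _ _.
Qed.

Lemma AGstar_semiheap (S : Type) (mul : S -> S -> S) :
  AGstar mul -> semiheap (natural_ternary mul).
Proof.
move=> AG x y z u v; have [rm wa] := AG; rewrite /natural_ternary.
have medial := right_modular_medial S mul rm.
have outer : mul (mul (mul (mul x y) z) u) v = mul (mul x y) (mul (mul z u) v).
  by rewrite (rm (mul x y) z u) (AGstar_mulC_left _ _ AG u) (wa (mul z u)).
have middle : mul x (mul (mul u z) y) = mul (mul (mul x y) z) u.
  rewrite (AGstar_mulC_inner _ _ AG x) -(wa y x) (rm (mul x y) z u).
  by rewrite (AGstar_mulC_left _ _ AG y) (AGstar_mulC_outer _ _ AG x).
rewrite middle; split; [reflexivity | exact: outer].
Qed.

Lemma AGstarstar_semiheap (S : Type) (mul : S -> S -> S) :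
  AGstarstar mul -> semiheap (natural_ternary mul).
Proof.
move=> [rm ll] x y z u v; rewrite /natural_ternary.
split; first by rewrite (rm (mul x y) z u) (ll (mul u z) x y).
have medial := right_modular_medial S mul rm.
(* [(x((uz)y))v = ((uz)(xy))v = (v(xy))(uz) = (vu)((xy)z) = (xy)((vu)z)], and [(vu)z = (zu)v]. *)
by rewrite (ll x) (rm (mul u z)) (medial v) (ll (mul v u)) (rm v).
Qed.

Theorem theorem18 (S : Type) (mul : S -> S -> S) :
  AGstar mul \/ AGstarstar mul ->
  semiheap (natural_ternary mul) /\
  laterally_commutative (natural_ternary mul).
Proof.
case=> AG; split.
- exact: AGstar_semiheap.
- exact: right_modular_laterally_commutative (proj1 AG).
- exact: AGstarstar_semiheap.
- exact: right_modular_laterally_commutative (proj1 AG).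
Qed.
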